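(* For $0<q<1$, $$\left(\sum_{j=0}^\infty q^{j(j+1)/2}\right)^3=\sum_{n=0}^\infty\sum_{j=-n}^n\left(\frac{1+q^{2n+1}}{1-q^{2n+1}}\right)q^{2n^2+2n-2j^2-j}.$$
   Context: The double sum is read as an outer sum over $n$ of the finite inner sums over $j$. *)

(* Defs.v *)
From HB Require Import structures.
From mathcomp Require Import all_boot all_order all_algebra.
From mathcomp Require Import all_classical all_reals all_analysis.

Set Implicit Arguments.
Unset Strict Implicit.
Unset Printing Implicit Defensive.

Import Order.TTheory GRing.Theory Num.Theory.
Import numFieldNormedType.Exports.

Local Open Scope ring_scope.

(* The sum of F j over the integers -n <= j <= n, indexed by k = j + n. *)
Definition symsum (R : realType) (n : nat) (F : int -> R) : R :=
  \sum_(0 <= k < n.*2.+1) F (k%:Z - n%:Z).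

(* The division by 2 is exact, since j * (j + 1) is even. *)
Definition tri_term (R : realType) (q : R) (j : nat) : R :=
  q ^+ ((j * (j + 1)) %/ 2).

(* The exponent is an integer expression in n and j; it is nonnegative for
   -n <= j <= n. *)
Definition cube_term (R : realType) (q : R) (n : nat) : R :=
  symsum n (fun j : int =>
    (1 + q ^+ (2 * n + 1)) / (1 - q ^+ (2 * n + 1))
    * q ^ (2 * n%:Z ^+ 2 + 2 * n%:Z - 2 * j ^+ 2 - j)).

(* Main.v *)
Require Import Defs.
From HB Require Import structures.
From mathcomp Require Import all_boot all_order all_algebra.
From mathcomp Require Import all_classical all_reals all_analysis.
From mathcomp Require Import ring zify.

Set Implicit Arguments.
Unset Strict Implicit.
Unset Printing Implicit Defensive.

Import Order.TTheory GRing.Theory Num.Theory.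
Import numFieldNormedType.Exports.

Local Open Scope classical_set_scope.
Local Open Scope ring_scope.

(** Write (a; p)_n for the product of 1 - a p^k over k < n. The identity is
    the limit, as N tends to infinity, of an identity between finite sums:
      sum_(n <= N) c_n w(N, n) = sum_(m <= N) q^m / P_m,
    where c_n is the n-th term of the double series,
      P_n = (q^2; q^2)_n / (q; q^2)_n   and
      w(N, n) = (q; q^2)_(N+1)^2 / ((q^2; q^2)_(N-n) (q^2; q^2)_(N+n+1)).

    The finite identity ([finite_identity]) is of the kind that Bailey's lemma
    produces. Passing from N - 1 to N, the weight of c_n increases by an
    explicit product ([weightS], in which the q-Saalschuetz sum is hidden), and
    the resulting sum over n becomes, after summation by parts, a sum of
    q^j / ((q^2; q^2)_(N-j) (q^2; q^2)_(N+j)) over -N <= j <= N. This is the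
    value of a Rogers-Szego polynomial at a point where it factors completely
    ([sum_even_products]), and what is left is q^N / P_N ([finite_step]).

    Let P be the limit of P_n. Two facts identify the pieces of the limit.
    - The function f(z) = sum_m z^m / P_m satisfies
      (1 - z) f(z) = (1 - q z) f(q^2 z); iterating from z = q gives
      f(q) = P_n f(q^(2n+1)), which tends to P since f(z) tends to 1 at 0. So
      the right-hand side of the finite identity tends to P ([cvg_gratio]).
    - The first 2n triangular powers of q sum to P_n times the first n terms
      of f(q^(2n+1)) ([shanks]), so the triangular series also has sum P:
      this is Gauss's product ([cvg_tri_series]).

    Finally w(N, n) increases with N to P^-2, so the nonnegative series of the
    c_n converges to P / P^-2 = P^3 by monotone convergence
    ([cvg_weighted_series]). *)

Section TriangularCube.
Variables (R : realType) (q : R).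
Hypotheses (hq0 : 0 < q) (hq1 : q < 1).

(** * Finite products and finite identities *)

(** The q-Pochhammer symbol (q; q^2)_n. *)
Definition podd n : R := \prod_(0 <= k < n) (1 - q ^+ k.*2.+1).

(** The q-Pochhammer symbol (q^2; q^2)_n. *)
Definition peven n : R := \prod_(0 <= k < n) (1 - q ^+ k.*2.+2).

Definition gratio n : R := peven n / podd n.

Lemma poddS n : podd n.+1 = podd n * (1 - q ^+ n.*2.+1).
Proof. by rewrite /podd big_nat_recr. Qed.

Lemma pevenS n : peven n.+1 = peven n * (1 - q ^+ n.*2.+2).
Proof. by rewrite /peven big_nat_recr. Qed.

Lemma onem_expr_gt0 n : 0 < 1 - q ^+ n.+1.
Proof. by rewrite subr_gt0 exprn_ilt1 ?ltW. Qed.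

Lemma podd_gt0 n : 0 < podd n.
Proof. by apply: prodr_gt0 => k _; exact: onem_expr_gt0. Qed.

Lemma peven_gt0 n : 0 < peven n.
Proof. by apply: prodr_gt0 => k _; exact: onem_expr_gt0. Qed.

Lemma gratio_gt0 n : 0 < gratio n.
Proof. by rewrite divr_gt0 ?podd_gt0 ?peven_gt0. Qed.

Let podd_neq0 n : podd n != 0. Proof. exact: lt0r_neq0 (podd_gt0 n). Qed.
Let peven_neq0 n : peven n != 0. Proof. exact: lt0r_neq0 (peven_gt0 n). Qed.
Let gratio_neq0 n : gratio n != 0. Proof. exact: lt0r_neq0 (gratio_gt0 n). Qed.
Let onem_neq0 n : 1 - q ^+ n.+1 != 0.
Proof. exact: lt0r_neq0 (onem_expr_gt0 n). Qed.

Lemma gratio0 : gratio 0 = 1.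
Proof. by rewrite /gratio /peven /podd !big_geq // divr1. Qed.

Lemma gratioS n :
  gratio n.+1 = gratio n * ((1 - q ^+ n.*2.+2) / (1 - q ^+ n.*2.+1)).
Proof.
by rewrite /gratio poddS pevenS; field; rewrite podd_neq0 onem_neq0.
Qed.

(** Up to the factor (q^2; q^2)_M, the value at q of the M-th Rogers-Szego
    polynomial in base q^2; in generating
    functions, 1 / ((z; q^2) (q z; q^2)) = 1 / (z; q). The left-hand side H_M
    satisfies (1 - q^(M+1)) H_(M+1) = H_M: with i = M + 1 - k, the k-th terms of
    the two sides differ by q^(M+1) (q^i - q^k) / ((q^2; q^2)_k (q^2; q^2)_i),
    which is antisymmetric under the exchange of k and i. *)
Lemma sum_even_products M :
  \sum_(0 <= k < M.+1) q ^+ k / (peven k * peven (M - k))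
  = (\prod_(0 <= k < M) (1 - q ^+ k.+1))^-1.
Proof.
elim: M => [|M IH].
  by rewrite big_nat1 /peven !big_geq // invr1 mulr1 expr0 divr1.
rewrite [X in _ = X^-1]big_nat_recr //= invfM -IH; apply: (mulIf (onem_neq0 M)).
rewrite mulfVK ?onem_neq0 //.
pose d k := peven k * peven (M.+1 - k).
have d0 k : d k != 0 by rewrite mulf_neq0.
have rev : \sum_(0 <= k < M.+2) q ^+ (M.+1 - k) / d k
         = \sum_(0 <= k < M.+2) q ^+ k / d k.
  rewrite big_nat_rev /= add0n; apply: eq_big_nat => k /andP[_ hk].
  by rewrite /d subSS subKn 1?mulrC 1?[X in _ / X]mulrC // mulrC.
have -> : \sum_(0 <= k < M.+1) q ^+ k / (peven k * peven (M - k))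
        = \sum_(0 <= k < M.+2) q ^+ k * (1 - q ^+ (M.+1 - k).*2) / d k.
  rewrite [RHS]big_nat_recr //= subnn expr0 subrr mulr0 mul0r addr0.
  apply: eq_big_nat => k /andP[_ hk]; rewrite /d subSn // pevenS doubleS.
  by field; rewrite !peven_neq0 onem_neq0.
rewrite mulr_suml; apply/eqP; rewrite -subr_eq0 -sumrB; apply/eqP.
transitivity (\sum_(0 <= k < M.+2)
    q ^+ M.+1 * (q ^+ (M.+1 - k) / d k - q ^+ k / d k)).
  apply: eq_big_nat => k /andP[_ hk]; rewrite -/(d k).
  have -> : q ^+ M.+1 = q ^+ k * q ^+ (M.+1 - k) by rewrite -exprD subnKC.
  by rewrite -muln2 exprM; field.
by rewrite -mulr_sumr sumrB rev subrr mulr0.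
Qed.

Lemma prod_odd_even m :
  \prod_(0 <= k < m.*2) (1 - q ^+ k.+1) = podd m * peven m.
Proof.
elim: m => [|m IH]; first by rewrite /podd /peven !big_geq ?mulr1.
by rewrite doubleS !big_nat_recr //= IH poddS pevenS; ring.
Qed.

Lemma symsumE n (F : int -> R) :
  symsum n F = F 0 + \sum_(0 <= i < n) (F i.+1%:Z + F (- i.+1%:Z)).
Proof.
elim: n => [|n IH]; first by rewrite /symsum big_nat1 subrr big_geq ?addr0.
rewrite [in RHS]big_nat_recr //= addrA -IH /symsum doubleS.
rewrite big_nat_recr // big_nat_recl //=.
have e : (n.*2.+2%:Z - n.+1%:Z = n.+1%:Z) by rewrite -addnn; lia.
rewrite e (eq_bigr (fun i => F (i%:Z - n%:Z))) => [|i _]; last by congr F; lia.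
by rewrite sub0r; ring.
Qed.

Lemma symsum_even_products N :
  symsum N (fun j => q ^ j / (peven `|N%:Z + j| * peven `|N%:Z - j|))
  = q ^- N / (podd N * peven N).
Proof.
rewrite -prod_odd_even -sum_even_products mulr_sumr; apply: eq_big_nat => k.
move=> /andP[_ hk]; rewrite mulrA; congr (_ / (peven _ * peven _)); try lia.
by rewrite addrC expfzDr ?lt0r_neq0 // -exprnN.
Qed.

(** The multiplier that turns the partial sums of the double series into a
    sum in closed form; for fixed n it tends to the inverse square of the limit
    of [gratio] as N grows. *)
Definition weight N n : R :=
  podd N.+1 ^+ 2 / (peven (N - n) * peven (N + n).+1).

(** The induction step of a terminating q-Saalschuetz sum. With x = q^(2N+3)
    and y = q^(2n+1) it is the factorization
      (1 - x)^2 - (1 - x / y) (1 - x y) = (x / y) (1 - y)^2.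
    The increment is nonnegative, which also makes the weight monotone in N. *)
Lemma weightS N n : (n <= N)%N ->
  weight N.+1 n = weight N n + podd N.+1 ^+ 2 * q ^+ (N.+1 - n).*2
      * (1 - q ^+ n.*2.+1) ^+ 2 / (peven (N.+1 - n) * peven (N.+1 + n).+1).
Proof.
move=> hn; rewrite /weight subSn // addSn !(poddS N.+1) !(pevenS (N - n)).
rewrite (pevenS (N + n).+1) !doubleS.
have -> : q ^+ (N.*2.+3) = q ^+ (N - n).*2.+2 * q ^+ n.*2.+1.
  by rewrite -exprD; congr (_ ^+ _); lia.
have e : q ^+ (N + n).*2.+4 = q ^+ (N - n).*2.+2 * q ^+ n.*2.+1 ^+ 2.
  by rewrite -exprM -exprD; congr (_ ^+ _); lia.
have := onem_neq0 (N + n).*2.+3; rewrite e => h.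
by field; rewrite h !peven_neq0 onem_neq0.
Qed.

Lemma weightnn N : weight N N = podd N.+1 ^+ 2 / peven N.*2.+1.
Proof. by rewrite /weight subnn addnn [peven 0]big_geq // mul1r. Qed.

Lemma abel_sum (N : nat) (a v : nat -> R) :
  \sum_(0 <= n < N) a n * (v n - v n.+1) + a N * v N
  = a 0 * v 0 + \sum_(0 <= n < N) (a n.+1 - a n) * v n.+1.
Proof.
elim: N => [|N IH]; first by rewrite !big_geq // addrC.
rewrite !big_nat_recr //= addrA -IH; ring.
Qed.

Definition inner_sum n : R :=
  symsum n (fun j : int => q ^ (- (2 * j ^+ 2 + j))).

Lemma cube_termE n : cube_term q n =
  (1 + q ^+ n.*2.+1) / (1 - q ^+ n.*2.+1) * q ^+ (2 * n * n.+1) * inner_sum n.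
Proof.
rewrite /cube_term /inner_sum /symsum mulr_sumr; apply: eq_bigr => k _.
rewrite -[in RHS](mulrA (_ / _)) -mul2n addn1; congr (_ * _).
rewrite [q ^+ (2 * n * _)]exprnP -expfzDr ?lt0r_neq0 //.
by congr (_ ^ _); rewrite !PoszM -natr1; ring.
Qed.

Lemma inner_sum0 : inner_sum 0 = 1.
Proof. by rewrite /inner_sum symsumE big_geq // addr0. Qed.

Lemma inner_sumS n : inner_sum n.+1 = inner_sum n
  + q ^- (2 * n.+1 * n.+1) * (q ^ n.+1%:Z + q ^ (- n.+1%:Z)).
Proof.
rewrite /inner_sum !symsumE big_nat_recr //= addrA; congr (_ + _).
rewrite exprnN mulrDr -!expfzDr ?lt0r_neq0 // addrC.
by congr (_ ^ _ + _ ^ _); rewrite !PoszM; ring.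
Qed.

(** The factor (1 - q^(2n+1))^2 of the increment of the weight cancels the
    denominator of [cube_term] and leaves 1 - q^(4n+2), which makes the
    coefficient of [inner_sum n] a difference v n - v n.+1. Summation by parts
    then replaces [inner_sum n] by its increments, and q^(2 n^2) in v n cancels
    the quadratic part of their exponents. *)
Lemma finite_step N :
  \sum_(0 <= n < N.+1) cube_term q n * (podd N ^+ 2 * q ^+ (N - n).*2
      * (1 - q ^+ n.*2.+1) ^+ 2 / (peven (N - n) * peven (N + n).+1))
  = q ^+ N / gratio N.
Proof.
pose v n : R := q ^+ (2 * n * n) / (peven (N - n) * peven (N + n)).
transitivity (podd N ^+ 2 * q ^+ N.*2 *
  (\sum_(0 <= n < N) inner_sum n * (v n - v n.+1) + inner_sum N * v N)).
  rewrite big_nat_recr //= mulrDr mulr_sumr; congr (_ + _).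
    apply: eq_big_nat => n /andP[_ hn]; rewrite cube_termE /v.
    (* The powers of q are expressed through q^(2(m+1)) and q^(2n), after which
       the equation is a rational identity in independent variables. *)
    have [m -> {hn}] : exists m, N = (m + n).+1.
      by exists (N - n).-1; lia.
    have -> : ((m + n).+1 - n = m.+1)%N by lia.
    have -> : ((m + n).+1 - n.+1 = m)%N by lia.
    have -> : ((m + n).+1 + n.+1 = ((m + n).+1 + n).+1)%N by lia.
    rewrite (pevenS m) (pevenS ((m + n).+1 + n)).
    have -> : q ^+ (2 * n * n.+1) = q ^+ (2 * n * n) * q ^+ n.*2.
      by rewrite -exprD; congr (_ ^+ _); lia.
    have -> : q ^+ (2 * n.+1 * n.+1)
            = q ^+ (2 * n * n) * (q ^+ n.*2 ^+ 2 * q ^+ 2).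
      by rewrite -exprM -!exprD; congr (_ ^+ _); lia.
    have -> : q ^+ (m + n).+1.*2 = q ^+ m.*2.+2 * q ^+ n.*2.
      by rewrite -exprD; congr (_ ^+ _); lia.
    have e : q ^+ ((m + n).+1 + n).*2.+2 = q ^+ m.*2.+2 * q ^+ n.*2.+1 ^+ 2.
      by rewrite -exprM -exprD; congr (_ ^+ _); lia.
    have h := onem_neq0 ((m + n).+1 + n).*2.+1; rewrite e in h *.
    have h2 := onem_neq0 n.*2; have h3 := onem_neq0 m.*2.+1.
    rewrite (exprS q n.*2) in h h2 *.
    have h4 := peven_neq0 m; have h5 := peven_neq0 ((m + n).+1 + n).
    move: (q ^+ m.*2.+2) (q ^+ n.*2) (peven m) (peven ((m + n).+1 + n))
      h h2 h3 h4 h5.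
    by move=> a b c d h h2 h3 h4 h5; field; rewrite h h2 h3 h4 h5.
  rewrite cube_termE /v subnn addnn pevenS.
  have -> : q ^+ (2 * N * N.+1) = q ^+ (2 * N * N) * q ^+ N.*2.
    by rewrite -exprD; congr (_ ^+ _); lia.
  have e : q ^+ N.*2.*2.+2 = q ^+ N.*2.+1 ^+ 2.
    by rewrite -exprM; congr (_ ^+ _); lia.
  have h := onem_neq0 N.*2.*2.+1; rewrite e in h *.
  by field; rewrite h !peven_neq0 onem_neq0.
rewrite abel_sum.
set F := fun j : int => q ^ j / (peven `|N%:Z + j| * peven `|N%:Z - j|).
have -> : inner_sum 0 * v 0
          + \sum_(0 <= n < N) (inner_sum n.+1 - inner_sum n) * v n.+1
        = symsum N F.
  rewrite symsumE; congr (_ + _).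
    rewrite inner_sum0 mul1r /v /F subn0 addn0 muln0 expr0 expr0z.
    by congr (_ / (peven _ * peven _)); lia.
  apply: eq_big_nat => n /andP[_ hn].
  rewrite inner_sumS addrAC subrr add0r /v /F.
  have -> : absz (N%:Z + n.+1) = (N + n.+1)%N by lia.
  have -> : absz (N%:Z - n.+1) = (N - n.+1)%N by lia.
  by field; rewrite !peven_neq0 expf_neq0 ?lt0r_neq0.
rewrite symsum_even_products /gratio -addnn exprD.
by field; rewrite podd_neq0 peven_neq0 expf_neq0 ?lt0r_neq0.
Qed.

Lemma finite_identity N :
  \sum_(0 <= n < N.+1) cube_term q n * weight N n
  = \sum_(0 <= m < N.+1) q ^+ m / gratio m.
Proof.
elim: N => [|N IH].
  rewrite !big_nat1 weightnn gratio0 cube_termE inner_sum0 pevenS poddS.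
  rewrite [peven 0]big_geq // [podd 0]big_geq //= muln0 mul0n !expr0 expr1.
  have h := onem_neq0 0; have h1 := onem_neq0 1; rewrite expr1 in h.
  by field; rewrite h h1.
rewrite [RHS]big_nat_recr //= -IH -finite_step.
rewrite [X in _ = _ + X]big_nat_recr //= addrA -big_split /=.
rewrite big_nat_recr //=; congr (_ + _).
  by apply: eq_big_nat => n /andP[_ hn]; rewrite weightS // mulrDr.
rewrite weightnn subnn poddS addnn; congr (_ * _).
by rewrite [peven 0]big_geq //; field; rewrite peven_neq0.
Qed.

(** * The limit of the quotients of products *)

Definition qseries (z : R) : R ^nat := series (fun m => z ^+ m / gratio m).

Lemma gratio_ge1 n : 1 <= gratio n.
Proof.
elim: n => [|n IH]; first by rewrite gratio0.
rewrite gratioS -[leLHS]mulr1 ler_pM // ler_pdivlMr ?onem_expr_gt0 // mul1r.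
by rewrite lerB // exprS ler_piMl ?ltW // exprn_gt0.
Qed.

Section QSeries.
Variable z : R.
Hypotheses (hz0 : 0 <= z) (hz1 : z < 1).

Lemma qseries_term_ge0 m : 0 <= z ^+ m / gratio m.
Proof. by rewrite divr_ge0 ?exprn_ge0 // ltW // gratio_gt0. Qed.

Lemma qseries_term_le m : z ^+ m / gratio m <= geometric 1 z m.
Proof.
by rewrite /= mul1r ler_piMr ?exprn_ge0 // invf_le1 ?gratio_gt0 ?gratio_ge1.
Qed.

Lemma is_cvg_qseries : cvgn (qseries z).
Proof.
apply: (series_le_cvg qseries_term_ge0 _ qseries_term_le).
  by move=> m; rewrite /= mul1r exprn_ge0.
by apply: is_cvg_geometric_series; rewrite ger0_norm.
Qed.

Lemma qseries_le_lim n : qseries z n <= limn (qseries z).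
Proof.
apply: nondecreasing_cvgn_le; last exact: is_cvg_qseries.
by apply: nondecreasing_series => m _ _; exact: qseries_term_ge0.
Qed.

Lemma lim_qseries_ge1 : 1 <= limn (qseries z).
Proof.
apply: le_trans (qseries_le_lim 1).
by rewrite /qseries seriesEnat /= big_nat1 gratio0 expr0 divr1.
Qed.

Lemma lim_qseries_le : limn (qseries z) <= (1 - z)^-1.
Proof.
have hz : `|z| < 1 by rewrite ger0_norm.
rewrite -[leRHS]mul1r -(cvg_lim _ (cvg_geometric_series (a := 1) hz)) //.
apply: lim_series_le qseries_term_le; first exact: is_cvg_qseries.
exact: is_cvg_geometric_series.
Qed.

(** For partial sums the equation (1 - z) f(z) = (1 - q z) f(q^2 z) holds up to
    a remainder of the order of z^N. *)
Lemma qseries_shift N : (1 - z) * qseries z N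
  = (1 - q * z) * qseries (q ^+ 2 * z) N
    - z ^+ N / gratio N * (1 - q ^+ N.*2).
Proof.
elim: N => [|N IH].
  by rewrite /qseries !seriesEnat /= !big_geq // !expr0 subrr !mulr0 subr0.
have e : qseries^~ N.+1 = fun y => qseries y N + y ^+ N / gratio N.
  by apply/funext => y; rewrite /qseries !seriesEnat /= big_nat_recr.
rewrite (congr1 (fun f => f z) e) (congr1 (fun f => f (q ^+ 2 * z)) e).
rewrite !mulrDr IH doubleS gratioS exprMn -exprM mul2n.
have := gratio_neq0 N; have := onem_neq0 N.*2; have := onem_neq0 N.*2.+1.
rewrite (exprS q N.*2.+1) (exprS q N.*2) (exprS z N).
move: (gratio N) (q ^+ N.*2) (z ^+ N) => g a b h1 h2 h3.
by field; rewrite h1 h2 h3.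
Qed.

End QSeries.

Lemma lim_qseries_shift z : 0 <= z -> z < 1 ->
  (1 - z) * limn (qseries z) = (1 - q * z) * limn (qseries (q ^+ 2 * z)).
Proof.
move=> hz0 hz1.
have h0 : 0 <= q ^+ 2 * z by rewrite mulr_ge0 // exprn_ge0 // ltW.
have h1 : q ^+ 2 * z < 1.
  by rewrite mulr_ilt1 // ?exprn_ilt1 // ?exprn_ge0 // ltW.
have term0 : z ^+ N / gratio N @[N --> \oo] --> 0.
  exact: cvg_series_cvg_0 (is_cvg_qseries hz0 hz1).
have rest0 : z ^+ N / gratio N * (1 - q ^+ N.*2) @[N --> \oo] --> 0.
  apply: (@squeeze_cvgr _ _ _ _ (cst 0) (fun N => z ^+ N / gratio N)) => //.
    near=> N; have t := qseries_term_ge0 hz0 N.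
    have := exprn_ge0 N.*2 (ltW hq0).
    have : q ^+ N.*2 <= 1 by rewrite exprn_ile1 ?ltW.
    by move=> a b; rewrite mulr_ge0 ?subr_ge0 // ler_piMr // lerBlDr lerDl.
  exact: cvg_cst.
have lhs : (1 - z) * qseries z N @[N --> \oo] --> (1 - z) * limn (qseries z).
  by apply: cvgM; [exact: cvg_cst | exact: is_cvg_qseries].
have rhs : (1 - z) * qseries z N @[N --> \oo]
    --> (1 - q * z) * limn (qseries (q ^+ 2 * z)) - 0.
  under eq_fun do rewrite qseries_shift.
  apply: cvgB => //; apply: cvgM; first exact: cvg_cst.
  exact: is_cvg_qseries h0 h1.
by rewrite (cvg_unique (@Rhausdorff R) lhs rhs) subr0.
Unshelve. all: by end_near. Qed.

Lemma lim_qseries_product n :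
  limn (qseries q) = gratio n * limn (qseries (q ^+ n.*2.+1)).
Proof.
elim: n => [|n ->]; first by rewrite gratio0 mul1r expr1.
have h0 : 0 <= q ^+ n.*2.+1 by rewrite exprn_ge0 ?ltW.
have h1 : q ^+ n.*2.+1 < 1 by rewrite exprn_ilt1 ?ltW.
have := lim_qseries_shift h0 h1.
rewrite -exprS -exprD gratioS doubleS => h.
apply: (mulfI (onem_neq0 n.*2)); rewrite mulrCA h.
by field; rewrite onem_neq0.
Qed.

Lemma cvg_onem_expr (a : nat -> nat) :
  (forall n, (n <= a n)%N) -> 1 - q ^+ a n @[n --> \oo] --> (1 : R).
Proof.
move=> ha; rewrite -[X in _ --> X]subr0; apply: cvgB; first exact: cvg_cst.
apply: (@squeeze_cvgr _ _ _ _ (cst 0) (fun n => q ^+ n)).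
- by near=> n; rewrite exprn_ge0 ?ler_wiXn2l // ltW.
- exact: cvg_cst.
by apply: cvg_expr; rewrite ger0_norm // ltW.
Unshelve. all: by end_near. Qed.

Lemma cvg_gratio : gratio @ \oo --> limn (qseries q).
Proof.
have lim1 : limn (qseries (q ^+ n.*2.+1)) @[n --> \oo] --> (1 : R).
  have hq n : q ^+ n.*2.+1 < 1 by rewrite exprn_ilt1 ?ltW.
  apply: (@squeeze_cvgr _ _ _ _ (cst 1) (fun n => (1 - q ^+ n.*2.+1)^-1)).
  - near=> n; rewrite lim_qseries_ge1 ?lim_qseries_le ?exprn_ge0 ?ltW //.
  - exact: cvg_cst.
  rewrite -[X in _ --> X]invr1; apply: cvgV; first exact: oner_neq0.
  by apply: cvg_onem_expr => n; lia.
have -> : gratio = fun n => limn (qseries q) / limn (qseries (q ^+ n.*2.+1)).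
  apply/funext => n; rewrite (lim_qseries_product n) mulfK //.
  rewrite lt0r_neq0 // (lt_le_trans ltr01) //.
  rewrite lim_qseries_ge1 ?exprn_ge0 ?ltW //.
  by rewrite exprn_ilt1 ?ltW.
rewrite -[X in _ --> X]divr1; apply: cvgM; first exact: cvg_cst.
by apply: cvgV; first exact: oner_neq0.
Unshelve. all: by end_near. Qed.

(** * Gauss's product *)

Lemma tri_term_double n : tri_term q n.*2 = q ^+ (n * n.*2.+1).
Proof. by rewrite /tri_term; congr (_ ^+ _); nia. Qed.

Lemma tri_term_doubleS n : tri_term q n.*2.+1 =
  q ^+ (n * n.*2.+1) * q ^+ n.*2.+1.
Proof. by rewrite -exprD /tri_term; congr (_ ^+ _); nia. Qed.

(** Shanks' finite form of Gauss's identity. When n grows by one, the change of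
    the terms with index s < n on the right-hand side is a difference
    u s.+1 - u s, up to a common factor, so only u n and the new term remain. *)
Lemma shanks n :
  series (tri_term q) n.*2 = gratio n * qseries (q ^+ n.*2.+1) n.
Proof.
elim: n => [|n IH]; first by rewrite /qseries !seriesEnat /= !big_geq ?mulr0.
rewrite doubleS !seriesSr IH tri_term_double tri_term_doubleS.
rewrite {IH} /qseries seriesSr mulrDr.
pose u s := q ^+ (s * n.*2.+1) * (1 - q ^+ s.*2) / gratio s.
have tel : gratio n.+1 * series (fun m => (q ^+ n.+1.*2.+1) ^+ m / gratio m) n
   - gratio n * series (fun m => (q ^+ n.*2.+1) ^+ m / gratio m) n
   = gratio n / (1 - q ^+ n.*2.+1) * u n.
  have -> : u n = \sum_(0 <= s < n) (u s.+1 - u s).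
    by rewrite telescope_sumr // /u expr0 subrr mulr0 mul0r subr0.
  rewrite !seriesEnat /= !mulr_sumr -sumrB; apply: eq_bigr => s _.
  rewrite /u gratioS (gratioS s) mulSn -!exprM exprD.
  have -> : q ^+ (n.+1.*2.+1 * s) = q ^+ (s * n.*2.+1) * q ^+ s.*2.
    by rewrite -exprD; congr (_ ^+ _); nia.
  rewrite (mulnC _ s) doubleS.
  have := gratio_neq0 s; have := onem_neq0 s.*2; have := onem_neq0 s.*2.+1.
  have := onem_neq0 n.*2.
  rewrite (exprS q n.*2.+1) (exprS q s.*2.+1) (exprS q s.*2) (exprS q n.*2).
  move: (gratio n) (gratio s) (q ^+ n.*2) (q ^+ s.*2) (q ^+ (s * _)).
  by move=> g f a b c h1 h2 h3 h4; field; rewrite h1 h2 h3 h4.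
apply/eqP; rewrite -subr_eq0; apply/eqP; move/eqP: tel.
rewrite subr_eq => /eqP ->; rewrite gratioS /u -!exprM.
have -> : q ^+ (n.+1.*2.+1 * n) = q ^+ (n * n.*2.+1) * q ^+ n.*2.
  by rewrite -exprD; congr (_ ^+ _); nia.
have := gratio_neq0 n; have := onem_neq0 n.*2.
rewrite (exprS q n.*2.+1) (exprS q n.*2).
move: (gratio n) (q ^+ n.*2) (q ^+ (n * _)).
by move=> g a b h1 h2; field; rewrite h1 h2.
Qed.

(** The even partial sums lie between [gratio n], the s = 0 term of Shanks'
    sum, and the full value f(q) = P_n f(q^(2n+1)). *)
Lemma cvg_tri_series : series (tri_term q) @ \oo --> limn (qseries q).
Proof.
have tri_ge0 j : 0 <= tri_term q j by rewrite exprn_ge0 ?ltW.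
have nd : {homo series (tri_term q) : m n / (m <= n)%N >-> m <= n}.
  by apply: nondecreasing_series => m _ _; exact: tri_ge0.
have hq n : q ^+ n.*2.+1 < 1 by rewrite exprn_ilt1 ?ltW.
have ub n : series (tri_term q) n.*2 <= limn (qseries q).
  rewrite shanks (lim_qseries_product n) ler_pM2l ?gratio_gt0 //.
  by rewrite qseries_le_lim ?exprn_ge0 ?ltW.
have cv : cvgn (series (tri_term q)).
  apply: nondecreasing_is_cvgn => //; exists (limn (qseries q)) => _ [n _ <-].
  by apply: le_trans (ub n); apply: nd; rewrite -addnn leq_addr.
have dbl : double @ \oo --> \oo.
  by apply/cvgnyPge => A; exists A => //= n /= An; lia.
have sq : series (tri_term q) n.*2 @[n --> \oo] --> limn (qseries q).
  apply: (@squeeze_cvgr _ _ _ _ gratio (cst (limn (qseries q)))).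
  - exists 1%N => // n /= n1; rewrite ub andbT shanks ler_peMr //.
      by rewrite ltW ?gratio_gt0.
    case: n n1 => // n _; rewrite /qseries seriesEnat /= big_nat_recl //=.
    rewrite expr0 gratio0 divr1 lerDl sumr_ge0 // => i _.
    by rewrite qseries_term_ge0 ?exprn_ge0 ?ltW.
  - exact: cvg_gratio.
  exact: cvg_cst.
have e := cvg_comp _ _ dbl cv.
by rewrite -(cvg_unique (@Rhausdorff R) e sq).
Qed.

(** * Passage to the limit *)

Lemma cvg_peven_ratio k : peven (n + k) / peven n @[n --> \oo] --> (1 : R).
Proof.
elim: k => [|k IH].
  under eq_fun do rewrite addn0 divff //.
  exact: cvg_cst.
have -> : (fun n => peven (n + k.+1) / peven n)
  = (fun n => peven (n + k) / peven n * (1 - q ^+ (n + k).*2.+2)).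
  by apply/funext => n; rewrite addnS pevenS mulrAC.
rewrite -[X in _ --> X]mulr1; apply: cvgM => //.
by apply: cvg_onem_expr => n; lia.
Qed.

(** In terms of [gratio] the weight is P_(N+1)^-2 times quotients of values of
    [peven] at indices a bounded distance apart, which tend to 1. *)
Lemma cvg_weight n : weight N n @[N --> \oo] --> (limn (qseries q)) ^- 2.
Proof.
rewrite -(cvg_shiftn n).
have -> : [sequence weight (N + n)%N n]_N = (fun N =>
    (gratio (N + n.+1))^-1 ^+ 2 * (peven (N + n.+1) / peven N) ^+ 2
    / (peven (N + n.*2.+1) / peven N)).
  apply/funext => N /=; rewrite /weight /gratio addnK !addnS -addnn addnA.
  by field; rewrite !peven_neq0 podd_neq0.
have lim0 : limn (qseries q) != 0.
  by rewrite lt0r_neq0 // (lt_le_trans ltr01) // lim_qseries_ge1 // ltW.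
have -> : limn (qseries q) ^- 2 = (limn (qseries q))^-1 ^+ 2 * 1 ^+ 2 / 1.
  by rewrite expr1n mulr1 divr1 exprVn.
apply: cvgM; last by apply: cvgV; [exact: oner_neq0 | exact: cvg_peven_ratio].
have sqr (u : R ^nat) (l : R) :
    u @ \oo --> l -> u N ^+ 2 @[N --> \oo] --> l ^+ 2.
  by move=> ul; under eq_fun do rewrite expr2; exact: cvgM.
apply: cvgM; apply: sqr; last exact: cvg_peven_ratio.
apply: cvgV => //; have := cvg_gratio.
by rewrite -(cvg_shiftn n.+1 gratio).
Qed.

(** For fixed n the weight is nondecreasing in N, hence below its limit. *)
Lemma weight_le n N : (n <= N)%N -> weight N n <= (limn (qseries q)) ^- 2.
Proof.
move=> hn; rewrite -(subnK hn).
have nd : {homo (fun M => weight (M + n) n) : a b / (a <= b)%N >-> a <= b}.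
  apply/nondecreasing_seqP => M; rewrite addSn weightS ?leq_addl // lerDl.
  apply: divr_ge0; last by rewrite ltW // mulr_gt0 ?peven_gt0.
  by apply: mulr_ge0 (sqr_ge0 _); rewrite mulr_ge0 ?sqr_ge0 ?exprn_ge0 // ltW.
have := cvg_weight n; rewrite -(cvg_shiftn n) => cv.
have := nondecreasing_cvgn_le nd _ (N - n); rewrite (cvg_lim _ cv) //; apply.
exact: cv.
Qed.

End TriangularCube.

(** Monotone convergence for weighted partial sums: for fixed M, the first M
    weighted terms are bounded by the whole weighted sum, which gives
    W * series c M <= L in the limit; conversely the weighted sum is at most W
    times the partial sum of c. The convergence of the series of c is thus part
    of the conclusion. *)
Lemma cvg_weighted_series (R : realType) (c : R ^nat) (w : nat -> R ^nat)
    (W L : R) :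
  0 < W -> (forall n, 0 <= c n) ->
  (forall N n, (n <= N)%N -> 0 <= w N n <= W) ->
  (forall n, w N n @[N --> \oo] --> W) ->
  (\sum_(0 <= n < N.+1) c n * w N n) @[N --> \oo] --> L ->
  series c @ \oo --> L / W.
Proof.
move=> W0 c0 wW wlim sL.
have partial M : series c M <= L / W.
  rewrite ler_pdivlMr // seriesEnat /= mulr_suml.
  have h : \sum_(0 <= n < M) c n * w N n @[N --> \oo]
           --> \sum_(0 <= n < M) c n * W.
    elim: M => [|M IH].
      under eq_fun do rewrite big_geq //.
      by rewrite big_geq //; exact: cvg_cst.
    under eq_fun do rewrite big_nat_recr //=.
    rewrite big_nat_recr //=; apply: cvgD => //.
    by apply: cvgM; [exact: cvg_cst|].
  apply: (ler_cvg_to h sL); exists M => // N /= MN.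
  rewrite [leRHS](big_cat_nat (n := M)) //= ?(leq_trans MN) // lerDl.
  rewrite big_nat_cond sumr_ge0 // => n /andP[/andP[_ nN] _].
  by rewrite mulr_ge0 //; case/andP: (wW N n nN).
rewrite -(cvg_shiftS (series c)).
apply: (@squeeze_cvgr _ _ _ _
  (fun N => (\sum_(0 <= n < N.+1) c n * w N n) / W) (cst (L / W))).
- near=> N; rewrite /= partial andbT ler_pdivrMr // seriesEnat /= mulr_suml.
  apply: ler_sum_nat => n /andP[_ nN].
  by rewrite ler_wpM2l //; case/andP: (wW N n nN).
- by apply: cvgM => //; exact: cvg_cst.
exact: cvg_cst.
Unshelve. all: by end_near. Qed.

Theorem mainTheorem13 (R : realType) (q : R) (hq0 : 0 < q) (hq1 : q < 1) :
  [/\ cvgn (series (tri_term q)),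
      cvgn (series (cube_term q)) &
      (limn (series (tri_term q))) ^+ 3 = limn (series (cube_term q))].
Proof.
have tri := cvg_tri_series hq0 hq1.
set P := limn (qseries q q) in tri.
have P0 : 0 < P by rewrite (lt_le_trans ltr01) // lim_qseries_ge1 // ltW.
have cube : series (cube_term q) @ \oo --> P / P ^- 2.
  apply: (@cvg_weighted_series _ _ (weight q)).
  - by rewrite invr_gt0 exprn_gt0.
  - move=> n; apply: sumr_ge0 => k _; rewrite mulr_ge0 ?exprz_ge0 ?ltW //.
    by rewrite mulr_gt0 ?addr_gt0 ?exprn_gt0 // invr_gt0 addn1 onem_expr_gt0.
  - move=> N n hn; rewrite weight_le // andbT divr_ge0 ?exprn_ge0 ?ltW //.
      exact: podd_gt0.
    by rewrite mulr_gt0 ?peven_gt0.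
  - by move=> n; exact: cvg_weight.
  have -> : (fun N => \sum_(0 <= n < N.+1) cube_term q n * weight q N n)
          = [sequence qseries q q N.+1]_N.
    by apply/funext => N /=; rewrite finite_identity // /qseries seriesEnat.
  by rewrite (cvg_shiftS (qseries q q)); apply: is_cvg_qseries; rewrite // ltW.
split; [exact: cvgP tri | exact: cvgP cube |].
by rewrite (cvg_lim _ tri) // (cvg_lim _ cube) // invrK -exprS.
Qed.
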